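(* Let $\eta:\mathbb{Z}\setminus\{0\}\to N$ be the function defined in the context. Then: (1) for every $n\in\mathbb{Z}\setminus\{0\}$, $(\eta(n))!$ is a multiple of $n$; (2) for every $n\in\mathbb{Z}\setminus\{0\}$, $\eta(n)$ is the smallest natural number $m\in N$ such that $m!$ is a multiple of $n$.
   Context: $N=\{0,1,2,3,\ldots\}$, $N^*=\{1,2,3,\ldots\}$, and $0!=1$. For a prime $p$ and $n\in N^*$ put $a_n^{(p)}=\frac{p^n-1}{p-1}$. Every $k\in N^*$ can be written uniquely in the form $k=t_1a_{n_1}^{(p)}+\cdots+t_l a_{n_l}^{(p)}$ with $l\in N^*$, integers $n_1>n_2>\cdots>n_l>0$, integers $t_j$ with $1\le t_j\le p-1$ for $1\le j\le l-1$, and $1\le t_l\le p$. The function $\eta_p:N^*\to N$ is defined, using this unique representation of $k$, by $\eta_p(k)=t_1p^{n_1}+\cdots+t_lp^{n_l}$ (in particular $\eta_p(a_n^{(p)})=p^n$). The function $\eta:\mathbb{Z}\setminus\{0\}\to N$ is defined by $\eta(\pm1)=0$ and, for $n\neq\pm1$ with prime factorization $n=\varepsilon\,p_1^{\alpha_1}\cdots p_s^{\alpha_s}$ (where $\varepsilon=\pm1$, $s\ge 1$, the $p_i$ are pairwise distinct positive primes and $\alpha_i\ge1$), by $\eta(n)=\max_{1\le i\le s}\eta_{p_i}(\alpha_i)$. *)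

(* Defs.v *)
From HB Require Import structures.
From mathcomp Require Import all_boot all_order all_algebra.
From mathcomp Require Import zify.
Set Implicit Arguments.
Unset Strict Implicit.
Unset Printing Implicit Defensive.

Local Open Scope nat_scope.

(* The quotient is exact for p > 1: it is 1 + p + ... + p ^ (n - 1). *)
Definition a_ (p n : nat) : nat := (p ^ n - 1) %/ (p - 1).

(* A representation k = t_1 a_{n_1} + ... + t_l a_{n_l} is encoded as the
   nonempty sequence [:: (t_1, n_1); ...; (t_l, n_l)]; the last coefficient
   alone is allowed to be equal to p. *)
Definition is_repr (p k : nat) (s : seq (nat * nat)) : bool :=
  match s with
  | [::] => false
  | x :: s' =>
    [&& sorted (fun u v => v.2 < u.2) s,
        all (fun u => 0 < u.2) s,
        all (fun u => 1 <= u.1 <= p - 1) (belast x s'),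
        1 <= (last x s').1 <= p
      & k == \sum_(u <- s) u.1 * a_ p u.2]
  end.

Arguments is_repr : simpl never.

Lemma a0 p : a_ p 0 = 0.
Proof. by rewrite /a_ expn0 subnn div0n. Qed.

Lemma aS p n : 1 < p -> a_ p n.+1 = p * a_ p n + 1.
Proof.
move=> p1.
have E m : p ^ m - 1 = a_ p m * (p - 1).
  rewrite /a_ divnK // !subn1.
  by rewrite predn_exp dvdn_mulr.
have p10 : 0 < p - 1 by rewrite subn_gt0.
apply/eqP; rewrite -(eqn_pmul2r p10) -E expnS mulnDl mul1n -mulnA -E.
have : 0 < p ^ n by rewrite expn_gt0; lia.
by move=> h; rewrite mulnBr muln1; apply/eqP; nia.
Qed.

Lemma a_gt0 p n : 1 < p -> 0 < n -> 0 < a_ p n.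
Proof. by move=> p1; case: n => // n _; rewrite aS // addn1. Qed.

Lemma leq_a p m n : 1 < p -> m <= n -> a_ p m <= a_ p n.
Proof.
move=> p1 /subnK <-; elim: (n - m) => // i IH.
by rewrite addSn aS // (leq_trans IH) // (leq_trans _ (leq_addr _ _)) // leq_pmull // ltnW.
Qed.

Lemma is_repr1 p k x :
  is_repr p k [:: x] = [&& 0 < x.2, 1 <= x.1 <= p & k == x.1 * a_ p x.2].
Proof. by rewrite /is_repr /= big_seq1 andbT. Qed.

Lemma is_repr_cons p k x y s :
  is_repr p (x.1 * a_ p x.2 + k) [:: x, y & s] =
  [&& y.2 < x.2, 0 < x.2, 1 <= x.1 <= p - 1 & is_repr p k (y :: s)].
Proof.
rewrite /is_repr /= (big_cons _ _ x) eqn_add2l.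
case: (y.2 < x.2) => //=; case: (0 < x.2) => //=; last by rewrite !andbF.
case: (0 < x.1 <= p - 1) => //=; by rewrite !andbF.
Qed.

Lemma is_repr_consP p k x y s : is_repr p k [:: x, y & s] ->
  exists2 r, k = x.1 * a_ p x.2 + r &
  [/\ y.2 < x.2, 0 < x.2, 1 <= x.1 <= p - 1 & is_repr p r (y :: s)].
Proof.
move=> H; exists (\sum_(u <- y :: s) u.1 * a_ p u.2).
  by case/and5P: H => _ _ _ _ /eqP ->; rewrite big_cons.
have := H; have /and5P[_ _ _ _ /eqP ->] := H.
by rewrite big_cons is_repr_cons => /and4P[].
Qed.

Lemma is_repr_exists p k : 1 < p -> 0 < k -> exists s, is_repr p k s.
Proof.
move=> p1 k0.
have main n : forall k, 0 < k -> k < a_ p n.+1 ->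
    exists x, exists2 s, x.2 <= n & is_repr p k (x :: s).
  elim: n => [|n IH] {k0}k k0; first by rewrite aS // a0; lia.
  case: (ltnP k (a_ p n.+1)) => [kn _|ak kn].
    by have [x [s xn H]] := IH _ k0 kn; exists x, s => //; apply: leqW.
  have A0 : 0 < a_ p n.+1 by apply: a_gt0.
  have kp : k <= p * a_ p n.+1 by move: kn; rewrite (aS n.+1) // addn1 ltnS.
  have t0 : 0 < k %/ a_ p n.+1 by rewrite divn_gt0.
  have kE := divn_eq k (a_ p n.+1).
  have rA : k %% a_ p n.+1 < a_ p n.+1 by rewrite ltn_mod.
  case: (posnP (k %% a_ p n.+1)) => [r0|r0].
    exists (k %/ a_ p n.+1, n.+1), [::] => //.
    rewrite is_repr1 /= t0 {2}kE r0 addn0 eqxx andbT.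
    by rewrite -(leq_pmul2r A0); move: kp; rewrite {1}kE r0 addn0.
  have [y [s yn H]] := IH _ r0 rA.
  exists (k %/ a_ p n.+1, n.+1), (y :: s) => //.
  rewrite {1}kE (is_repr_cons _ _ (k %/ a_ p n.+1, n.+1)) /= ltnS yn t0 H andbT /=.
  have : k %/ a_ p n.+1 < p.
    by rewrite -(ltn_pmul2r A0); apply: leq_trans kp; rewrite [ltnRHS]kE; lia.
  by lia.
have [|x [s _ H]] := main k k k0; last by exists (x :: s).
elim: k {k0 main} => [|k IH]; first by rewrite aS // addn1.
rewrite aS // addn1 ltnS; apply: leq_trans IH _.
by rewrite leq_pmull // ltnW.
Qed.

Lemma is_repr_bounds p k x s : 1 < p -> is_repr p k (x :: s) ->
  0 < k /\ k <= p * a_ p x.2.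
Proof.
move=> p1; elim: s x k => [|y s IH] x k.
  rewrite is_repr1 => /and3P[x0 /andP[t0 tp] /eqP ->].
  by rewrite muln_gt0 t0 a_gt0 // leq_mul2r tp orbT.
move=> /is_repr_consP[r -> [yx x0 /andP[t0 tp] /IH[r0 rp]]].
have := leq_a p1 yx; rewrite aS // => le_a; split; first by lia.
have : x.1.+1 * a_ p x.2 <= p * a_ p x.2 by rewrite leq_mul2r; lia.
by rewrite mulSn; lia.
Qed.

Lemma is_repr_divn p k x s : 1 < p -> is_repr p k (x :: s) ->
  exists2 r, k = x.1 * a_ p x.2 + r &
  [/\ 0 < x.1, 0 < x.2, r < a_ p x.2
    & if s is [::] then r = 0 else is_repr p r s].
Proof.
move=> p1; case: s => [|y s].
  rewrite is_repr1 => /and3P[x0 /andP[t0 tp] /eqP ->].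
  by exists 0; rewrite ?addn0 //; split => //; apply: a_gt0.
move=> /is_repr_consP[r -> [yx x0 /andP[t0 tp] H]].
exists r => //; split => //.
have [_ rp] := is_repr_bounds p1 H.
by have := leq_a p1 yx; rewrite aS //; lia.
Qed.

Lemma is_repr_unique p k s1 s2 : 1 < p ->
  is_repr p k s1 -> is_repr p k s2 -> s1 = s2.
Proof.
move=> p1; elim: s1 s2 k => [|x s1 IH] [|y s2] k // H1 H2.
have [_ u1] := is_repr_bounds p1 H1; have [_ u2] := is_repr_bounds p1 H2.
have [r1 E1 [tx nx l1 R1]] := is_repr_divn p1 H1.
have [r2 E2 [ty ny l2 R2]] := is_repr_divn p1 H2.
have no u v : k <= p * a_ p u -> a_ p v <= k -> v <= u.
  move=> ku vk; rewrite leqNgt; apply/negP => uv.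
  by have := leq_a p1 uv; rewrite aS //; lia.
have n12 : x.2 = y.2.
  apply/eqP; rewrite eqn_leq; apply/andP; split; apply: no => //.
    by rewrite E1 (leq_trans (leq_pmull _ tx)) // leq_addr.
  by rewrite E2 (leq_trans (leq_pmull _ ty)) // leq_addr.
move: E2 l2; rewrite -n12 => E2 l2.
have t12 : x.1 = y.1.
  have := congr1 (divn^~ (a_ p x.2)) (etrans (esym E1) E2).
  by rewrite !divnMDl ?(leq_ltn_trans _ l1) // !divn_small // !addn0.
have r12 : r1 = r2 by move: E1 E2; rewrite t12 => -> /addnI.
have -> : x = y by case: (x) (y) n12 t12 => ? ? [? ?] /= -> ->.
congr cons; move: R1 R2; rewrite -r12.
have pos z s : is_repr p r1 (z :: s) -> r1 <> 0.
  by move=> H; have [] := is_repr_bounds p1 H; lia.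
case: s1 s2 {H1 H2} IH => [|z1 s1] [|z2 s2] IH //.
- by move=> r0 /pos.
- by move=> /pos.
by move=> R1 R2; apply: IH R1 R2.
Qed.

Lemma is_repr_total p k :
  exists s, (prime p && (0 < k)) ==> is_repr p k s.
Proof.
case: (boolP (prime p && (0 < k))) => [/andP[pp k0]|_]; last by exists [::].
by have [s] := is_repr_exists (prime_gt1 pp) k0; exists s.
Qed.

(* The representation is unique by is_repr_unique; the_repr p k is an
   unspecified sequence when p is not prime or k = 0. *)
Definition the_repr (p k : nat) : seq (nat * nat) := xchoose (is_repr_total p k).

Definition eta_p (p k : nat) : nat := \sum_(u <- the_repr p k) u.1 * p ^ u.2.

Lemma eta_pE p k s : prime p -> is_repr p k s ->
  eta_p p k = \sum_(u <- s) u.1 * p ^ u.2.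
Proof.
move=> pp H; have p1 := prime_gt1 pp.
have k0 : 0 < k.
  by case: s H => // x s H; have [] := is_repr_bounds p1 H.
have H' : is_repr p k (the_repr p k).
  by apply: (implyP (xchooseP (is_repr_total p k))); rewrite pp.
by rewrite /eta_p (is_repr_unique p1 H' H).
Qed.

Lemma eta_p_a p n : prime p -> 0 < n -> eta_p p (a_ p n) = p ^ n.
Proof.
move=> pp n0; have p1 := prime_gt1 pp.
rewrite (@eta_pE _ _ [:: (1, n)]) // ?big_seq1 ?mul1n //.
by rewrite is_repr1 /= n0 ltnW //= mul1n.
Qed.

(* logn p `|n| is the exponent of p in n; for n = 1 or -1 the maximum is taken
   over an empty sequence and equals 0.  The value at n = 0 is irrelevant. *)
Definition etaZ (n : int) : nat :=
  \max_(p <- primes `|n|%N) eta_p p (logn p `|n|%N).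

(* Main.v *)
(* Write v(m) for the exponent of p in m!, so that v(p ^ n) = a_n.
   Superadditivity of v gives v(eta_p k) >= k.  Conversely, v is additive on
   base-p expansions, and eta_p k - 1 has the expansion of eta_p k with its last
   term t p ^ n replaced by (t - 1) p ^ n + (p ^ n - 1), which costs
   v(p ^ n) - v(p ^ n - 1) = n > 0; hence v(eta_p k - 1) < k.  So k <= v(m) iff
   eta_p k <= m, and the theorem follows prime by prime. *)
Require Import Defs.
From HB Require Import structures.
From mathcomp Require Import all_boot all_order all_algebra.
From mathcomp Require Import zify.
Set Implicit Arguments.
Unset Strict Implicit.
Unset Printing Implicit Defensive.

Local Open Scope nat_scope.

(** Peels the top term off the geometric sum, matching the recursion for the exponent of [p] in the
    factorial of [p ^ n]. *)
Lemma a_Sexp p n : 1 < p -> a_ p n.+1 = p ^ n + a_ p n.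
Proof.
have aE m : 1 < p -> a_ p m = \sum_(i < m) p ^ i.
  by move=> p1; rewrite /a_ !subn1 predn_exp mulKn //; lia.
by move=> p1; rewrite !aE // big_ord_recr addnC.
Qed.

Lemma logn_factS p n : logn p n.+1`! = logn p n.+1 + logn p n`!.
Proof. by rewrite factS lognM ?fact_gt0. Qed.

(** The binomial coefficient is an integer, so m! n! divides (m + n)!. *)
Lemma logn_fact_superadd p m n :
  logn p m`! + logn p n`! <= logn p (m + n)`!.
Proof.
rewrite -lognM ?fact_gt0 // dvdn_leq_log ?fact_gt0 //.
by rewrite -(bin_fact (leq_addr n m)) addKn dvdn_mull.
Qed.

Lemma leq_logn_fact p m n : m <= n -> logn p m`! <= logn p n`!.
Proof.
move=> /subnKC <-; apply: leq_trans (logn_fact_superadd p m (n - m)).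
exact: leq_addr.
Qed.

(** Legendre's recursion: only the factors p, 2p, ..., mp count, and their product is p^m m!. *)
Lemma logn_fact_mulD p m b : prime p -> b < p ->
  logn p (p * m + b)`! = m + logn p m`!.
Proof.
move=> pp; have drop c n : c < p -> logn p (p * n + c)`! = logn p (p * n)`!.
  elim: c => [|c IHc] cp; first by rewrite addn0.
  rewrite addnS logn_factS IHc 1?ltnW // -addnS lognE.
  by rewrite dvdn_addr ?dvdn_mulr // gtnNdvd // !andbF.
move=> bp; rewrite drop //; elim: m => [|m IHm]; first by rewrite muln0 logn1.
have p0 := prime_gt0 pp.
have -> : p * m.+1 = (p * m + p.-1).+1 by lia.
rewrite logn_factS drop ?IHm; last by lia.
have -> : (p * m + p.-1).+1 = p * m.+1 by lia.
by rewrite lognM // logn_prime // eqxx logn_factS; lia.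
Qed.

Lemma logn_fact_exp p n : prime p -> logn p (p ^ n)`! = a_ p n.
Proof.
move=> pp; elim: n => [|n IH]; first by rewrite logn1 a0.
rewrite a_Sexp ?prime_gt1 // -IH expnS -[p * _]addn0.
by rewrite logn_fact_mulD ?prime_gt0.
Qed.

(** Induction on [n]: [logn_fact_mulD] strips the lowest base-[p] digit, which is a digit of [r]. *)
Lemma logn_fact_expD p n t r : prime p -> t < p -> r < p ^ n ->
  logn p (t * p ^ n + r)`! = t * a_ p n + logn p r`!.
Proof.
move=> pp tp; have p0 := prime_gt0 pp.
elim: n r => [|n IH] r rn.
  move: rn; rewrite ltnS leqn0 => /eqP ->.
  by rewrite a0 muln1 muln0 addn0 -[t]add0n -{1}(muln0 p) logn_fact_mulD.
rewrite (divn_eq r p) [_ %/ p * p]mulnC addnA expnS mulnCA -mulnDr.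
have qn : r %/ p < p ^ n by rewrite ltn_divLR // mulnC -expnS.
by rewrite !logn_fact_mulD ?ltn_mod // IH // a_Sexp ?prime_gt1 //; lia.
Qed.

Lemma leq_logn_fact_eta p k : prime p -> 0 < k ->
  k <= logn p (eta_p p k)`!.
Proof.
move=> pp k0; have [s H] := is_repr_exists (prime_gt1 pp) k0.
rewrite (eta_pE pp H).
have -> : k = \sum_(u <- s) u.1 * a_ p u.2.
  by case: s H => // x s /and5P[_ _ _ _ /eqP].
elim: s {H} => [|x s IH]; first by rewrite !big_nil.
rewrite !big_cons; apply: leq_trans (logn_fact_superadd _ _ _).
(* The term t p^n is split into t copies of p^n, each contributing exactly a_n. *)
rewrite leq_add //; elim: x.1 => // t IHt.
rewrite !mulSn; apply: leq_trans (logn_fact_superadd _ _ _).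
by rewrite logn_fact_exp // leq_add2l.
Qed.

(** Applied to the tail after a term t p^n, this bounds its value by p^n; the predecessor of that
    value is then a valid remainder in [logn_fact_expD]. *)
Lemma repr_value_bounds p k x s : 1 < p -> is_repr p k (x :: s) ->
  0 < \sum_(u <- x :: s) u.1 * p ^ u.2 <= p ^ x.2.+1.
Proof.
move=> p1; have p0 := ltnW p1.
elim: s x k => [|y s IH] x k.
  rewrite is_repr1 big_seq1 expnS => /and3P[_ /andP[t0 tp] _].
  by rewrite muln_gt0 t0 expn_gt0 p0 leq_mul2r tp orbT.
move=> /is_repr_consP[r _ [yx _ /andP[_ tp] /IH /andP[e0 ep]]].
rewrite big_cons addn_gt0 e0 orbT /=.
have := leq_trans ep (leq_pexp2l p0 yx) => {}ep.
have : x.1.+1 * p ^ x.2 <= p ^ x.2.+1 by rewrite expnS leq_mul2r; lia.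
by rewrite mulSn; lia.
Qed.

Lemma ltn_logn_fact_repr p k x s : prime p -> is_repr p k (x :: s) ->
  logn p (\sum_(u <- x :: s) u.1 * p ^ u.2).-1`! < k.
Proof.
move=> pp; have p1 := prime_gt1 pp; have p0 := prime_gt0 pp.
elim: s x k => [|y s IH] x k.
  rewrite is_repr1 big_seq1 => /and3P[n0 /andP[t0 tp] /eqP ->].
  have q0 : 0 < p ^ x.2 by rewrite expn_gt0 p0.
  (* Even when [x.1] equals [p], the new leading coefficient is below [p]. *)
  have -> : (x.1 * p ^ x.2).-1 = x.1.-1 * p ^ x.2 + (p ^ x.2).-1 by nia.
  rewrite logn_fact_expD //; [|lia..].
  have := logn_factS p (p ^ x.2).-1.
  by rewrite prednK // logn_fact_exp // pfactorK //; nia.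
move=> /is_repr_consP[r -> [yx _ /andP[_ tp] H]].
have /andP[e0 ep] := repr_value_bounds p1 H.
have {}ep := leq_trans ep (leq_pexp2l p0 yx).
rewrite big_cons.
(* The tail is positive, so it absorbs the predecessor and the leading term stays intact. *)
have -> a b : 0 < b -> (a + b).-1 = a + b.-1 by lia.
  rewrite logn_fact_expD //; [|lia..].
  by rewrite ltn_add2l IH.
by [].
Qed.

Lemma leq_logn_factE p k m : prime p -> 0 < k ->
  (k <= logn p m`!) = (eta_p p k <= m).
Proof.
move=> pp k0; apply/idP/idP => [|le_eta_m]; last first.
  exact: leq_trans (leq_logn_fact_eta pp k0) (leq_logn_fact p le_eta_m).
apply: contraTT; rewrite -!ltnNge => lt_m_eta.
have [s H] := is_repr_exists (prime_gt1 pp) k0.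
case: s H => // x s H; have := ltn_logn_fact_repr pp H.
rewrite -(eta_pE pp H); apply: leq_ltn_trans.
by apply: leq_logn_fact; lia.
Qed.

(** Divisibility is tested on each prime-power part of [n], and a maximum is at most [m] iff each
    entry is. *)
Lemma dvdz_factE (n : int) m : n <> 0%R ->
  (n %| Posz m`!)%Z = (etaZ n <= m).
Proof.
move=> n0; have an0 : 0 < `|n|%N by lia.
rewrite dvdzE /= /etaZ.
have E p : p \in primes `|n|%N ->
    (`|n|%N`_p %| m`!) = (eta_p p (logn p `|n|%N) <= m).
  move=> pn; have pp : prime p by move: pn; rewrite mem_primes => /and3P[].
  have lp : 0 < logn p `|n|%N by rewrite logn_gt0.
  by rewrite p_part pfactor_dvdn ?fact_gt0 // leq_logn_factE.
apply/(dvdn_partP _ an0)/bigmax_leqP_seq => [H p pn _|H p pn].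
  by rewrite -E //; apply: H.
by rewrite E //; apply: H.
Qed.

Theorem theorem2 :
  (forall n : int, n <> 0%R -> (n %| Posz (etaZ n)`!)%Z) /\
  (forall n : int, n <> 0%R ->
     (n %| Posz (etaZ n)`!)%Z /\
     (forall m : nat, (n %| Posz m`!)%Z -> etaZ n <= m)).
Proof.
have dvd n : n <> 0%R -> (n %| Posz (etaZ n)`!)%Z.
  by move=> n0; rewrite dvdz_factE.
split=> // n n0; split; first exact: dvd.
by move=> m; rewrite dvdz_factE.
Qed.
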